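(* Let $R$ be a finite local ring whose unique maximal ideal $M$ has order $m$. Then the unitary Cayley graph $G_R$ is Ramanujan if and only if one of the following holds: (a) $|R|=2m$; (b) $|R|\geq\left(\frac{m}{2}+1\right)^2$ and $m\neq 2$.
   Context: Rings are commutative with identity $1\neq 0$. For a finite commutative ring $R$, $R^\times$ denotes its group of units. The unitary Cayley graph $G_R$ is the graph with vertex set $R$ in which $x,y\in R$ are adjacent if and only if $x-y\in R^\times$; it is $|R^\times|$-regular. A local ring is a commutative ring with a unique maximal ideal. The eigenvalues of a graph are those of its adjacency matrix. A finite $r$-regular graph is Ramanujan if every eigenvalue $\lambda$ with $\lambda\neq \pm r$ satisfies $|\lambda|\le 2\sqrt{r-1}$. *)

(* Defs.v *)
From HB Require Import structures.
From mathcomp Require Export all_boot all_order all_algebra.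
From mathcomp Require Export reals.

Set Implicit Arguments.
Unset Strict Implicit.
Unset Printing Implicit Defensive.

Import GRing.Theory.
Local Open Scope ring_scope.

(* [idealr_closed] includes the condition 1 \notin I, i.e. properness. *)
Definition maximal_ideal (R : finComUnitRingType) (I : {set R}) : Prop :=
  idealr_closed I /\
  forall J : {set R}, idealr_closed J -> I \subset J -> J = I.

Definition local_ring_with (R : finComUnitRingType) (M : {set R}) : Prop :=
  maximal_ideal M /\ forall I : {set R}, maximal_ideal I -> I = M.

Record sgraph := SGraph {
  vertex :> finType;
  adj : rel vertex;
  adj_sym : symmetric adj;
  adj_irr : irreflexive adj
}.

Definition regular (G : sgraph) (r : nat) : Prop :=
  forall x : G, #|[set y | adj x y]| = r.

Definition adjmx (K : nzRingType) (G : sgraph) : 'M[K]_#|G| :=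
  \matrix_(i, j) (adj (enum_val i) (enum_val j))%:R.

(* Eigenvalues are taken in K: the adjacency matrix is real symmetric, so this
   loses nothing with respect to complex eigenvalues.  The degree r is
   determined by G as soon as G has a vertex. *)
Definition Ramanujan (K : realType) (G : sgraph) : Prop :=
  exists r : nat, regular G r /\
    forall a : K, eigenvalue (adjmx K G) a ->
      a <> r%:R -> a <> - r%:R -> `|a| <= 2 * Num.sqrt (r%:R - 1).

Section UnitaryCayley.
Variable R : finComUnitRingType.

Definition unitary_adj : rel R := fun x y => x - y \is a GRing.unit.

Lemma unitary_adj_sym : symmetric unitary_adj.
Proof. by move=> x y; rewrite /unitary_adj -opprB unitrN. Qed.

Lemma unitary_adj_irr : irreflexive unitary_adj.
Proof. by move=> x; rewrite /unitary_adj subrr unitr0. Qed.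

Definition unitary_Cayley : sgraph :=
  SGraph unitary_adj_sym unitary_adj_irr.
End UnitaryCayley.

(* Main.v *)
(** Every non-unit of a finite ring lies in a maximal ideal, so [M] is the set
    of non-units and [G_R] is complete multipartite with the cosets of [M] as
    parts.  An eigenfunction [f] for [a] therefore satisfies
    [\sum f - \sum_(x + M) f = a * f x]; summing this over [R], and then over a
    coset of [M], shows that [a] is [|R| - m], [- m] or [0].  The eigenvalue
    [- m] is attained by the difference of the indicators of [M] and [1 + M],
    and [m <= 2 * sqrt (|R| - m - 1)] is the inequality of (b).  When [m = 2],
    multiplication by the nonzero element of [M] gives [|R| = 4], which is
    case (a). *)
Require Import Defs.
From mathcomp Require Import ring lra zify.
Set Implicit Arguments.
Unset Strict Implicit.
Unset Printing Implicit Defensive.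
Import Order.TTheory GRing.Theory Num.Theory.
Local Open Scope ring_scope.

(** * Eigenvalues through functions on the vertices *)

Lemma eigenvalue_adjmxP (K : fieldType) (G : sgraph) (a : K) :
  eigenvalue (adjmx K G) a <->
  exists2 f : G -> K, exists x, f x != 0 &
    forall x, \sum_(y | adj x y) f y = a * f x.
Proof.
split.
  move/eigenvalueP=> [v vA v0]; exists (fun x => v 0 (enum_rank x)).
    case/rV0Pn: v0 => i vi; exists (enum_val i); by rewrite enum_valK.
  move=> x; move/rowP/(_ (enum_rank x)): vA; rewrite !mxE => <-.
  rewrite (reindex_onto enum_rank enum_val) /=; last by move=> i _; rewrite enum_valK.
  rewrite big_mkcond [RHS]big_mkcond; apply: eq_bigr => y _.
  (* [eigenvalue] concerns row vectors [v *m A]; symmetry of [adj] turns the column sum into a sum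
     over neighbours. *)
  rewrite mxE !enum_rankK eqxx adj_sym.
  by case: (adj y x); rewrite ?mulr1 ?mulr0.
move=> [f [x fx] fA]; apply/eigenvalueP; exists (\row_i f (enum_val i)).
  apply/rowP=> i; rewrite !mxE -fA.
  rewrite (reindex_onto enum_rank enum_val) /=; last by move=> j _; rewrite enum_valK.
  rewrite big_mkcond [RHS]big_mkcond; apply: eq_bigr => y _.
  rewrite !mxE !enum_rankK eqxx adj_sym.
  by case: (adj (enum_val i) y); rewrite ?mulr1 ?mulr0.
by apply/rV0Pn; exists (enum_rank x); rewrite mxE enum_rankK.
Qed.

(** * Maximal ideals and their cosets *)

Lemma idealr_closed_maximal (R : finComUnitRingType) (I : {set R}) :
  idealr_closed I -> exists2 J : {set R}, maximal_ideal J & I \subset J.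
Proof.
(* A boolean form of [idealr_closed], as [maxset_exists] requires. *)
pose idealb (J : {set R}) := [&& 0 \in J, 1 \notin J &
  [forall a, forall u, forall v, (u \in J) ==> (v \in J) ==> (a * u + v \in J)]].
have idP (J : {set R}) : reflect (idealr_closed J) (idealb J).
  apply: (iffP and3P) => [[J0 J1 JM]|[J0 J1 JM]]; split=> //.
    move=> a u v uJ vJ.
    by move/forallP/(_ a)/forallP/(_ u)/forallP/(_ v)/implyP/(_ uJ)/implyP/(_ vJ): JM.
  apply/forallP=> a; apply/forallP=> u; apply/forallP=> v.
  by apply/implyP=> uJ; apply/implyP=> vJ; apply: JM.
move/idP=> /maxset_exists[J /maxsetP[/idP JI Jmax] IJ]; exists J => //.
by split=> // L /idP; apply: Jmax.
Qed.

Section LocalRing.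
Variables (R : finComUnitRingType) (M : {set R}).
Hypothesis hM : local_ring_with M.

Lemma local_ring_idealr_closed : idealr_closed M.
Proof. by case: hM => [[]]. Qed.

Lemma local_ring_unitE (x : R) : (x \is a GRing.unit) = (x \notin M).
Proof.
have [M0 M1 MM] := local_ring_idealr_closed.
apply/idP/idP=> [xu|].
  apply/negP=> xM; move: M1; rewrite -(mulVr xu) -[X in X \notin _]addr0.
  by rewrite MM.
apply: contraR => xN.
(* The principal ideal of the non-unit [x] is proper, so some maximal ideal, necessarily [M],
   contains it. *)
have [|J Jmax xJ] := @idealr_closed_maximal R [set x * y | y in R].
  split; first by apply/imsetP; exists 0; rewrite ?mulr0.
    apply/imsetP=> -[y _ xy]; case/negP: xN.
    by apply/unitrPr; exists y.
  move=> a _ _ /imsetP[u _ ->] /imsetP[v _ ->].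
  by apply/imsetP; exists (a * u + v) => //; ring.
have <- : J = M by case: hM => _ /(_ _ Jmax).
by apply: (subsetP xJ); apply/imsetP; exists 1; rewrite ?mulr1.
Qed.

Lemma local_ring_memD (x y : R) : x \in M -> y \in M -> x + y \in M.
Proof.
have [_ _ MM] := local_ring_idealr_closed.
by move=> xM yM; rewrite -[x]mul1r MM.
Qed.

Lemma local_ring_memB (x y : R) : x \in M -> y \in M -> x - y \in M.
Proof.
have [M0 _ MM] := local_ring_idealr_closed.
by move=> xM yM; rewrite addrC -mulN1r MM.
Qed.

Lemma local_ring_mem_coset (x y z : R) :
  x - z \in M -> (x - y \in M) = (z - y \in M).
Proof.
move=> xzM; apply/idP/idP=> h.
  have -> : z - y = (x - y) - (x - z) by ring.
  exact: local_ring_memB.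
have -> : x - y = (x - z) + (z - y) by ring.
exact: local_ring_memD.
Qed.

Lemma card_coset_left (x : R) : #|[pred y | x - y \in M]| = #|M|.
Proof.
rewrite -(card_imset M (inv_inj (subKr x))).
apply: eq_card => y; rewrite inE; apply/idP/imsetP => [h|[z zM ->]].
  by exists (x - y); rewrite // subKr.
by rewrite subKr.
Qed.

Lemma card_coset_right (y : R) : #|[pred x | x - y \in M]| = #|M|.
Proof.
rewrite -(card_imset M (addIr y)).
apply: eq_card => x; rewrite inE; apply/idP/imsetP => [h|[z zM ->]].
  by exists (x - y); rewrite // subrK.
by rewrite addrK.
Qed.

Lemma local_ring_card_gt0 : (0 < #|M|)%N.
Proof. by apply/card_gt0P; exists 0; case: local_ring_idealr_closed. Qed.

Lemma local_ring_card_ge : (2 * #|M| <= #|R|)%N.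
Proof.
have [M0 M1 _] := local_ring_idealr_closed.
(* [M] and [1 + M] are disjoint: a common [x] would put [1 = x - (x - 1)] in [M]. *)
rewrite mul2n -addnn -[X in (_ + X <= _)%N](card_coset_right 1).
rewrite -cardUI addnC [X in (X + _)%N]eq_card0 ?max_card // => x.
rewrite !inE; apply/negP=> /andP[xM /(local_ring_memB xM)].
by rewrite subKr; apply/negP.
Qed.

(* If [M = {0, x}], then [r |-> r * x] takes values in [M], and both of its
   fibres lie in a coset of [M], as its kernel consists of non-units. *)
Lemma local_ring_card_max2 : #|M| = 2%N -> #|R| = 4%N.
Proof.
move=> M2; have := local_ring_card_ge; rewrite M2 => ge4.
apply/eqP; rewrite eqn_leq ge4 andbT.
have [M0 _ MM] := local_ring_idealr_closed.
have [x xM x0] : exists2 x, x \in M & x != 0.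
  have : (0 < #|M :\ 0%R|)%N by have := cardsD1 0 M; rewrite M0 M2 add1n => -[<-].
  by move=> /card_gt0P[x]; rewrite !inE => /andP[]; exists x.
have ME : M = [set 0; x].
  apply/esym/eqP; rewrite eqEcard subUset !sub1set M0 xM M2.
  by rewrite cards2 eq_sym x0.
have ann r : r * x = 0 -> r \in M.
  move=> rx; apply: contraT; rewrite -local_ring_unitE => ru.
  by case/eqP: x0; apply: (mulrI ru); rewrite rx mulr0.
have := cardUI M [pred r : R | r - 1 \in M].
rewrite card_coset_right M2 => e; rewrite -[4%N]e.
apply: leq_trans (leq_addr _ _); apply: subset_leq_card.
apply/subsetP=> r _; rewrite !inE.
have : r * x \in M by rewrite -[r * x]addr0 MM.
rewrite {1}ME !inE => /orP[/eqP/ann -> //|/eqP rx].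
by rewrite (ann (r - 1)) ?orbT // mulrBl rx mul1r subrr.
Qed.

Lemma regular_unitary_Cayley : regular (unitary_Cayley R) (#|R| - #|M|).
Proof.
move=> x; rewrite -(card_coset_left x) -(cardC [pred y | x - y \in M]) addKn.
by apply: eq_card => y; rewrite !inE /= /unitary_adj local_ring_unitE.
Qed.

(** [Ramanujan] leaves the degree existential; counting the neighbours of 0 pins it down. *)
Lemma regular_unitary_Cayley_uniq (r : nat) :
  regular (unitary_Cayley R) r -> r = (#|R| - #|M|)%N.
Proof. by move=> h; rewrite -(h 0) regular_unitary_Cayley. Qed.

(** * Spectrum of the unitary Cayley graph *)

Section Spectrum.
Variable K : numFieldType.
Implicit Types f : R -> K.

(** The non-neighbours of [x], itself included, form [x + M]. *)
Lemma sum_unitary_adj f x :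
  \sum_(y | unitary_adj x y) f y = \sum_y f y - \sum_(y | x - y \in M) f y.
Proof.
rewrite [X in _ = X - _](bigID [pred y | x - y \in M]) /= addrAC subrr add0r.
apply: eq_bigl => y.
by rewrite /unitary_adj local_ring_unitE.
Qed.

(** Each [f y] is counted once for every [x] in [y + M]. *)
Lemma sum_coset_sum f :
  \sum_x \sum_(y | x - y \in M) f y = #|M|%:R * \sum_x f x.
Proof.
rewrite (exchange_big_dep predT) //= mulr_sumr; apply: eq_bigr => y _.
by rewrite sumr_const card_coset_right mulr_natl.
Qed.

(** The inner sum depends only on the coset of [z], so it is constant over [x + M]. *)
Lemma coset_sum_coset_sum f x :
  \sum_(z | x - z \in M) \sum_(y | z - y \in M) f y =
  #|M|%:R * \sum_(y | x - y \in M) f y.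
Proof.
transitivity (\sum_(z | x - z \in M) \sum_(y | x - y \in M) f y).
  apply: eq_bigr => z xz; apply: eq_bigl => y.
  by rewrite (local_ring_mem_coset y xz).
by rewrite sumr_const card_coset_left mulr_natl.
Qed.

Lemma unitary_Cayley_eigenvalue (a : K) :
  eigenvalue (adjmx K (unitary_Cayley R)) a ->
  [\/ a = (#|R| - #|M|)%N%:R, a = - #|M|%:R | a = 0].
Proof.
move/eigenvalue_adjmxP=> [f [x0 fx0] /= fA].
have {}fA x : \sum_y f y - \sum_(y | x - y \in M) f y = a * f x.
  by rewrite -fA sum_unitary_adj.
have [S0|S0] := eqVneq (\sum_y f y) 0; last first.
  constructor 1; rewrite natrB ?max_card //; apply: (mulIf S0).
  transitivity (\sum_x a * f x); first by rewrite mulr_sumr.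
  under eq_bigr do rewrite -fA.
  rewrite sumrB sum_coset_sum sumr_const -[X in X - _]mulr_natl mulrBl.
  by congr (_%:R * _ - _); apply: eq_card.
have {}fA x : - \sum_(y | x - y \in M) f y = a * f x by rewrite -fA S0 sub0r.
(* If the coset sum at [x0] vanishes, then [a * f x0 = 0]; otherwise the equation is summed over
   [x0 + M] and that sum cancels. *)
have [P0|P0] := eqVneq (\sum_(y | x0 - y \in M) f y) 0.
  constructor 3; apply: (mulIf fx0).
  by rewrite -fA P0 oppr0 mul0r.
constructor 2; apply: (mulIf P0); rewrite mulr_sumr.
under eq_bigr do rewrite -fA.
by rewrite sumrN coset_sum_coset_sum mulNr.
Qed.

Lemma unitary_Cayley_eigenvalueN :
  eigenvalue (adjmx K (unitary_Cayley R)) (- #|M|%:R).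
Proof.
have [M0 M1 _] := local_ring_idealr_closed.
apply/eigenvalue_adjmxP.
exists (fun x : R => (x \in M)%:R - (x - 1 \in M)%:R).
  exists (0 : R); rewrite M0 -[0 - 1 \in M]negbK -local_ring_unitE.
  by rewrite sub0r unitrN1 subr0 oner_neq0.
(* Both indicators have total [#|M|], so the total sum vanishes; the function is constant on cosets,
   so its sum over [x + M] is [#|M|] times its value at [x]. *)
move=> x /=; rewrite sum_unitary_adj sumrB -!natr_sum.
have -> : (\sum_y (y \in M) = #|M|)%N by rewrite -sum1_card [RHS]big_mkcond.
have -> : (\sum_y (y - 1 \in M)%R = #|M|)%N.
  by rewrite -(card_coset_right 1) -sum1_card [RHS]big_mkcond.
rewrite subrr sub0r mulNr; congr (- _).
rewrite -[#|M|](card_coset_left x) mulr_natl -sumr_const; apply: eq_bigr => y xy.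
have := local_ring_mem_coset 0 xy; rewrite !subr0 => ->.
by rewrite (local_ring_mem_coset 1 xy).
Qed.

End Spectrum.
End LocalRing.

(** * The Ramanujan bound *)

Lemma le_double_sqrt (K : rcfType) (m n : K) : 0 < m ->
  (m <= 2 * Num.sqrt (n - m - 1)) = ((m / 2 + 1) ^+ 2 <= n).
Proof.
move=> m0; rewrite mulrC -ler_pdivrMr //.
have h0 : 0 < m / 2 by rewrite divr_gt0.
have [n0|n0] := leP 0 (n - m - 1).
  (* Squaring gives [(m / 2) ^+ 2 <= n - m - 1]; adding [m + 1] completes the square. *)
  rewrite -[X in (X <= _) = _](ger0_norm (ltW h0)) -sqrtr_sqr ler_sqrt //.
  by apply/idP/idP; nra.
(* The root of a negative number is 0, so the left side fails; so does the right, since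
   [n < m + 1]. *)
rewrite (ler0_sqrtr (ltW n0)) leNgt h0; apply/esym/negbTE; rewrite -ltNge.
by nra.
Qed.

Theorem theorem3p1 (K : realType) (R : finComUnitRingType) (M : {set R})
    (m : nat) (hM : local_ring_with M) (hm : #|M| = m) :
  Ramanujan K (unitary_Cayley R) <->
  (#|R| = (2 * m)%N \/
   ((#|R|%:R >= (m%:R / 2 + 1) ^+ 2 :> K) /\ m <> 2%N)).
Proof.
have m0 : 0 < m%:R :> K by rewrite ltr0n -hm (local_ring_card_gt0 hM).
have le2m : (2 * m <= #|R|)%N by rewrite -hm (local_ring_card_ge hM).
have rE : (#|R| - m)%N%:R = #|R|%:R - m%:R :> K by rewrite natrB //; lia.
split=> [[r [/(regular_unitary_Cayley_uniq hM) -> ram]]|cond].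
  rewrite hm in ram; have [->|neq] := eqVneq #|R| (2 * m)%N; first by left.
  right; split; last first.
    by move=> m2; rewrite (local_ring_card_max2 hM (etrans hm m2)) m2 in neq.
  (* The bound is tested at [- m]: it differs from the degree by its sign, and from minus the degree
     because [#|R|] is not [2 * m]. *)
  have := ram (- m%:R); rewrite -{1}hm normrN gtr0_norm // rE le_double_sqrt //.
  apply.
  - exact: unitary_Cayley_eigenvalueN.
  - rewrite -rE => e; have := ler0n K (#|R| - m).
    by rewrite -e oppr_ge0 leNgt m0.
  - rewrite -rE => /oppr_inj/eqP; rewrite eqr_nat => /eqP e.
    by case/eqP: neq; lia.
exists (#|R| - m)%N; split; first by rewrite -hm; apply: regular_unitary_Cayley.
move=> a /(unitary_Cayley_eigenvalue hM); rewrite hm => -[-> //|->|->] _.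
  rewrite normrN gtr0_norm // rE le_double_sqrt // -rE.
  (* In case (a) the degree is [m], so the eigenvalue [- m] is exempt from the bound. *)
  case: cond => [e|[]//]; case; rewrite e; congr (- _%:R); lia.
by rewrite normr0 mulr_ge0 ?sqrtr_ge0.
Qed.
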